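(* Let $\mathcal{K}_{DC}$ be the $n\times n$ DC kernel, with entries $$(\mathcal{K}_{DC})_{ij}=c\,\lambda^{\frac{i+j}{2}}\rho^{|i-j|},\qquad i,j=1,\dots,n,$$ where $c\ge 0$, $0\le\lambda<1$, $-1\le\rho\le 1$. Then $\mathcal{K}_{DC}$ satisfies the following properties. (i) $\mathcal{K}_{DC}$ admits the factorization $$\mathcal{K}_{DC}=UWU^\top$$ with $U$ upper triangular and Toeplitz, with entries $$U_{ij}=\begin{cases}1 & \text{if } i=j,\\ 0 & \text{if } i>j,\\ \dfrac{\rho^{\,j-i}}{\lambda^{(j-i)/2}} & \text{otherwise,}\end{cases}$$ and $W$ diagonal, given by $$W=(1-\rho^2)\,\mathrm{diag}\left\{\lambda,\lambda^2,\dots,\lambda^{n-1},\frac{\lambda^n}{1-\rho^2}\right\}.$$ (ii) $\mathcal{K}_{DC}^{-1}$ is a tridiagonal banded matrix given by $$\left(\mathcal{K}_{DC}^{-1}\right)_{i,j}=\frac{c_{ij}}{1-\rho^2}\,(-1)^{i+j}\,\lambda^{-\frac{i+j}{2}}\,\rho^{|i-j|},$$ where $$c_{ij}=\begin{cases}0 & \text{if } |i-j|>1,\\ 1+\rho^2 & \text{if } i=j=2,\dots,n-1,\\ 1 & \text{otherwise,}\end{cases}$$ and it factors as $$\mathcal{K}_{DC}^{-1}=LVL^\top$$ with $L$ Toeplitz, lower triangular and banded, with entries $$L_{ij}=\begin{cases}1 & \text{if } i=j,\\ -\dfrac{\rho}{\sqrt{\lambda}} & \text{if } j=i-1,\\ 0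 & \text{otherwise,}\end{cases}$$ and $V$ diagonal, given by $$V=\frac{1}{1-\rho^2}\,\mathrm{diag}\left\{\frac1\lambda,\frac1{\lambda^2},\dots,\frac1{\lambda^{n-1}},\frac{1-\rho^2}{\lambda^n}\right\}.$$ (iii) The DC kernel has determinant $$\det\left(\mathcal{K}_{DC}\right)=\lambda^{\frac{n(n+1)}{2}}\left(1-\rho^2\right)^{n-1}.$$
   Context: $\mathrm{diag}\{a_1,\dots,a_n\}$ denotes the diagonal matrix with diagonal entries $a_1,\dots,a_n$. The numbers $c_{ij}$ in (ii) are coefficients defined there and are distinct from the scale factor $c$ of the kernel.
   Formalization: The formulas hold only for c=1; factors c, 1/c, c^n are inserted in (i), (ii), (iii). (i) assumes λ≠0, with last entry of W read as λ^n; (ii) assumes c≠0, λ≠0, ρ²≠1, and its entry formula n≥2 (for n=1 it fails unless ρ=0). *)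

(* Defs.v *)
From HB Require Import structures.
From mathcomp Require Import all_boot all_order all_algebra.
From mathcomp Require Import reals exp.

Set Implicit Arguments.
Unset Strict Implicit.
Unset Printing Implicit Defensive.

Import Order.TTheory GRing.Theory Num.Theory.
Local Open Scope ring_scope.

(* Ordinals start at 0, so the row or column i : 'I_n is the one with
   mathematical index i.+1. Differences of indices are unaffected. *)

Definition toeplitz_mx (R : Type) (m n : nat) (A : 'M[R]_(m, n)) : Prop :=
  forall (i i' : 'I_m) (j j' : 'I_n),
    i%:Z - j%:Z = i'%:Z - j'%:Z -> A i j = A i' j'.

(* is_trig_mx means lower triangular. *)
Definition upper_trig_mx (R : nmodType) (m n : nat) (A : 'M[R]_(m, n)) : bool :=
  is_trig_mx A^T.

(* Bandwidth w on each side of the main diagonal; w = 1 is tridiagonal. *)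
Definition banded_mx (R : nmodType) (w m n : nat) (A : 'M[R]_(m, n)) : Prop :=
  forall (i : 'I_m) (j : 'I_n), (w < `|i - j|)%N -> A i j = 0.

Definition dc_kernel (R : realType) (n : nat) (c lam rho : R) : 'M[R]_n :=
  \matrix_(i < n, j < n)
    (c * lam `^ ((i.+1 + j.+1)%:R / 2) * rho ^+ `|i - j|%N).

Definition dcU (R : realType) (n : nat) (lam rho : R) : 'M[R]_n :=
  \matrix_(i < n, j < n)
    (if i == j then 1
     else if (j < i)%N then 0
     else rho ^+ (j - i)%N / lam `^ ((j - i)%N%:R / 2)).

(* (1 - rho^2) diag(lam, ..., lam^(n-1), lam^n / (1 - rho^2)), with the factor
   distributed over the diagonal so that the last entry, lam^n, keeps its
   meaning when rho^2 = 1. *)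
Definition dcW (R : realType) (n : nat) (lam rho : R) : 'M[R]_n :=
  diag_mx (\row_(i < n)
    (if (i.+1 < n)%N then (1 - rho ^+ 2) * lam ^+ i.+1 else lam ^+ n)).

Definition dc_coef (R : realType) (n : nat) (rho : R) (i j : 'I_n) : R :=
  if (1 < `|i - j|)%N then 0
  else if (i == j) && (1 < i.+1 < n)%N then 1 + rho ^+ 2
  else 1.

Definition dcL (R : realType) (n : nat) (lam rho : R) : 'M[R]_n :=
  \matrix_(i < n, j < n)
    (if i == j then 1
     else if j.+1 == i :> nat then - (rho / Num.sqrt lam)
     else 0).

Definition dcV (R : realType) (n : nat) (lam rho : R) : 'M[R]_n :=
  (1 - rho ^+ 2)^-1 *: diag_mx (\row_(i < n)
    (if (i.+1 < n)%N then (lam ^+ i.+1)^-1 else (1 - rho ^+ 2) / lam ^+ n)).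

(* Main.v *)
Require Import Defs.
From HB Require Import structures.
From mathcomp Require Import all_boot all_order all_algebra.
From mathcomp Require Import reals exp.
From mathcomp Require Import zify ring.

Set Implicit Arguments.
Unset Strict Implicit.
Unset Printing Implicit Defensive.

Import Order.TTheory GRing.Theory Num.Theory.
Local Open Scope ring_scope.

(** Put s = sqrt lam and r = rho / s, so that half-integer powers of lam become
    integer powers of s and the kernel K has entries
    c s^(i+j) rho^|i-j|.  The transpose of L is the identity minus r times the
    upper shift: multiplying by it on the left subtracts from each row r times
    the next one ([trmx_dcL_mulmxE]).  Two such row reductions give everything.
    Applied to U, whose row i holds the powers of r from column i on, the
    reduction telescopes to the identity ([trmx_dcL_dcU]), so the transpose of
    L is the inverse of U.  Applied to K, it cancels all entries above the
    diagonal, since there K_ij = r K_(i+1)j, and on and below it leaves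
    c w_i r^(i-j), the entries of c W U^T ([trmx_dcL_kernel]).  Hence
    K = c U W U^T.

    If c and lam are nonzero and rho^2 != 1, inverting the factors gives K^-1 = c^-1 L V L^T, because V is the
    inverse of W; multiplying out the bidiagonal L gives the tridiagonal entries
    ([LVL_E]).  Since U is unitriangular, det K is c^n times the product of the
    diagonal of W.  For lam = 0, where r has no meaning, K = 0 and the
    determinant formula is immediate. *)

Section DCKernel.
Variables (R : realType) (n : nat) (lam rho : R).
Local Notation s := (Num.sqrt lam).
Local Notation r := (rho / Num.sqrt lam).
Local Notation L := (dcL n lam rho).
Local Notation U := (dcU n lam rho).
Local Notation W := (dcW n lam rho).
Local Notation V := (dcV n lam rho).

Lemma powR_half (k : nat) : 0 <= lam -> lam `^ (k%:R / 2) = s ^+ k.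
Proof.
by move=> lam_ge0; rewrite mulrC powRrM powR12_sqrt // powR_mulrn // sqrtr_ge0.
Qed.

(** The columns are given by a function on nat rather than on ordinals, so that
    the neighbouring row i.-1 or i.+1 is named without a bound proof, also when
    it lies outside the matrix. *)
Lemma dcL_mulmxE (m : nat) (f : nat -> nat -> R) :
  L *m \matrix_(i < n, j < m) f i j =
  \matrix_(i, j) (f i j - (if (0 < i)%N then r * f i.-1 j else 0)).
Proof.
apply/matrixP => i j; rewrite !mxE (bigD1 i) //= !mxE eqxx mul1r; congr (_ + _).
case: ifPn => [i_gt0 | i0].
  have hi : (i.-1 < n)%N by have := ltn_ord i; lia.
  rewrite (bigD1 (Ordinal hi)) /=; last by rewrite -val_eqE /=; lia.
  rewrite big1 ?addr0.
    by rewrite !mxE -val_eqE /= ifF ?prednK ?eqxx ?mulNr //; lia.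
  move=> k /andP[]; rewrite -!val_eqE /= => ki ki1.
  by rewrite !mxE -val_eqE /= !ifF ?mul0r //; lia.
rewrite oppr0 big1 // => k; rewrite -val_eqE /= => ki.
by rewrite !mxE -val_eqE /= !ifF ?mul0r //; lia.
Qed.

Lemma trmx_dcL_mulmxE (m : nat) (f : nat -> nat -> R) :
  L^T *m \matrix_(i < n, j < m) f i j =
  \matrix_(i, j) (f i j - (if (i.+1 < n)%N then r * f i.+1 j else 0)).
Proof.
apply/matrixP => i j; rewrite !mxE (bigD1 i) //= !mxE eqxx mul1r; congr (_ + _).
case: ifPn => [hi | i0].
  rewrite (bigD1 (Ordinal hi)) /=; last by rewrite -val_eqE /=; lia.
  rewrite big1 ?addr0.
    by rewrite !mxE -val_eqE /= ifF ?eqxx ?mulNr //; lia.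
  move=> k /andP[]; rewrite -!val_eqE /= => ki ki1.
  by rewrite !mxE -val_eqE /= !ifF ?mul0r //; lia.
rewrite oppr0 big1 // => k; rewrite -val_eqE /= => ki.
by rewrite !mxE -val_eqE /= !ifF ?mul0r //; have := ltn_ord k; lia.
Qed.

Lemma dcUE : 0 <= lam ->
  U = \matrix_(i, j) (if (i <= j)%N then r ^+ (j - i) else 0).
Proof.
move=> lam_ge0; apply/matrixP => i j; rewrite !mxE -val_eqE /=.
by case: ltngtP => [ij|//|->]; rewrite ?subnn // powR_half // expr_div_n.
Qed.

Lemma dc_kernelE (c : R) : 0 <= lam ->
  dc_kernel n c lam rho =
  \matrix_(i, j) (c * s ^+ (i.+1 + j.+1) * rho ^+ `|i - j|%N).
Proof. by move=> lam_ge0; apply/matrixP => i j; rewrite !mxE powR_half. Qed.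

(** Row i of U, minus r times row i.+1, loses every entry to the right of the
    diagonal because consecutive powers of r cancel. *)
Lemma trmx_dcL_dcU : 0 <= lam -> L^T *m U = 1%:M.
Proof.
move=> lam_ge0; rewrite dcUE //.
rewrite (trmx_dcL_mulmxE n
  (fun i j => if (i <= j)%N then r ^+ (j - i) else 0)).
apply/matrixP => i j; rewrite !mxE -val_eqE /=.
have := ltn_ord j; case: (ltngtP i j) => ij jn.
- by rewrite ifT ?subnSK -?exprS ?subnSK ?subrr //; lia.
- by case: ifP; rewrite ?mulr0 subr0.
- by rewrite ij subnn ?mulr0; case: ifP; rewrite subr0.
Qed.

Lemma dcU_trmx_dcL : 0 <= lam -> U *m L^T = 1%:M.
Proof. by move=> lam_ge0; apply: mulmx1C; apply: trmx_dcL_dcU. Qed.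

(** On and below the diagonal, subtracting r times the next row multiplies the entry
    by 1 - rho^2; in the last row there is nothing to subtract.  This is why the
    last entry of W lacks the factor 1 - rho^2, and why the identity also holds
    for rho^2 = 1. *)
Lemma trmx_dcL_kernel (c : R) : 0 < lam ->
  L^T *m dc_kernel n c lam rho = c *: (W *m U^T).
Proof.
move=> lam_gt0; have lam_ge0 := ltW lam_gt0.
have s_neq0 : s != 0 by rewrite sqrtr_eq0 -ltNge.
have lamE : lam = s ^+ 2 by rewrite sqr_sqrtr.
rewrite dc_kernelE //.
rewrite (trmx_dcL_mulmxE n
  (fun i j => c * s ^+ (i.+1 + j.+1) * rho ^+ `|i%:Z - j%:Z|%N)).
rewrite dcUE // /dcW mul_diag_mx; apply/matrixP => i j; rewrite !mxE.
have := ltn_ord i; have := ltn_ord j.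
case: (leqP j i) => [ji | ij] jn iN; last first.
  (* Strictly above the diagonal row i is r times row i.+1, so it cancels. *)
  rewrite ifT; last lia.
  have -> : `|i%:Z - j%:Z|%N = (j - i.+1).+1 by lia.
  have -> : `|i.+1%:Z - j%:Z|%N = (j - i.+1)%N by lia.
  by rewrite addSn !exprS; field.
have -> : `|i%:Z - j%:Z|%N = (i - j)%N by lia.
have -> : `|i.+1%:Z - j%:Z|%N = (i - j).+1 by lia.
have -> : (i.+1 + j.+1 = j.+1 + j.+1 + (i - j))%N by lia.
have -> : (i.+2 + j.+1 = (j.+1 + j.+1 + (i - j)).+1)%N by lia.
(* The weight w_i carries s^(2 i.+1), which splits off the power of s in the
   denominator of r^(i-j). *)
have ei : s ^+ (2 * i.+1) = s ^+ (j.+1 + j.+1 + (i - j)) * s ^+ (i - j).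
  by rewrite -exprD; congr (_ ^+ _); lia.
case: ifPn => [_ | iN'].
  rewrite [in X in _ = c * (_ * X * _)]lamE -exprM ei expr_div_n !exprS.
  by field; rewrite s_neq0 expf_neq0.
have nE : n = i.+1 by lia.
have -> : lam ^+ n = s ^+ (2 * i.+1) by rewrite exprM -lamE -nE.
by rewrite ei expr_div_n; field; rewrite expf_neq0.
Qed.

Lemma dc_kernel_UWU (c : R) : 0 < lam ->
  dc_kernel n c lam rho = c *: (U *m W *m U^T).
Proof.
move=> lam_gt0; rewrite -mulmxA scalemxAr -trmx_dcL_kernel //.
by rewrite mulmxA dcU_trmx_dcL ?ltW // mul1mx.
Qed.

Lemma toeplitz_dcL : toeplitz_mx L.
Proof.
move=> i i' j j' ij; rewrite !mxE -!val_eqE /=.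
have -> : (i == j :> nat) = (i' == j' :> nat) by lia.
by have -> : (j.+1 == i) = (j'.+1 == i') by lia.
Qed.

Lemma toeplitz_dcU : toeplitz_mx U.
Proof.
move=> i i' j j' ij; rewrite !mxE -!val_eqE /=.
have -> : (i == j :> nat) = (i' == j' :> nat) by lia.
have -> : (j < i)%N = (j' < i')%N by lia.
by case: ifP => // _; case: ltnP => // _; have -> : (j - i = j' - i')%N by lia.
Qed.

Lemma upper_trig_dcU : upper_trig_mx U.
Proof.
by apply/is_trig_mxP => i j ij; rewrite !mxE -val_eqE /= ij ifF //; lia.
Qed.

Lemma is_trig_dcL : is_trig_mx L.
Proof.
by apply/is_trig_mxP => i j ij; rewrite !mxE -val_eqE /= !ifF //; lia.
Qed.

Lemma banded_dcL : banded_mx 1 L.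
Proof. by move=> i j ij; rewrite !mxE -val_eqE /= !ifF //; lia. Qed.

Lemma dcW_dcV : lam != 0 -> rho ^+ 2 != 1 -> W *m V = 1%:M.
Proof.
move=> lam_neq0 rho_neq1; have d_neq0 : 1 - rho ^+ 2 != 0.
  by rewrite subr_eq0 eq_sym.
rewrite /dcV -scalemxAr mulmx_diag; apply/matrixP => i j; rewrite !mxE.
case: eqP => _; rewrite ?mulr0n ?mulr0 // !mulr1n.
by case: ifP => _; field; rewrite ?expf_neq0.
Qed.

(** U^T L and U L^T are both the identity and W V is too, so the product
    collapses from the middle outwards. *)
Lemma dc_kernel_LVL (c : R) : c != 0 -> 0 < lam -> rho ^+ 2 != 1 ->
  dc_kernel n c lam rho *m (c^-1 *: (L *m V *m L^T)) = 1%:M.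
Proof.
move=> c_neq0 lam_gt0 rho_neq1; rewrite dc_kernel_UWU //.
have UL : U^T *m L = 1%:M.
  by rewrite -(trmxK L) -trmx_mul trmx_dcL_dcU ?ltW // trmx1.
rewrite -scalemxAl -scalemxAr scalerA divff // scale1r.
have -> : U *m W *m U^T *m (L *m V *m L^T) =
          U *m (W *m (U^T *m L) *m V) *m L^T.
  by rewrite !mulmxA.
by rewrite UL mulmx1 dcW_dcV ?(gt_eqF lam_gt0) // mulmx1 dcU_trmx_dcL // ltW.
Qed.

(** With V = diag(v), the entry (i, j) is v_i L_ji - r v_(i-1) L_j(i-1).  Off
    the diagonal at most one of the two terms survives.  On the diagonal the
    entry is v_i + r^2 v_(i-1), which for an interior index is 1 + rho^2 times
    1 / ((1 - rho^2) lam^i.+1); at the first index the second term is absent,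
    and at the last one (1 - rho^2) + rho^2 = 1.  For n = 1 the single index is
    both first and last, and the formula fails unless rho = 0. *)
Lemma LVL_E : (1 < n)%N -> 0 < lam -> rho ^+ 2 != 1 -> forall i j : 'I_n,
  (L *m V *m L^T) i j =
  dc_coef rho i j / (1 - rho ^+ 2) * (-1) ^+ (i.+1 + j.+1)
  * lam `^ (- ((i.+1 + j.+1)%:R / 2)) * rho ^+ `|i - j|%N.
Proof.
move=> n_gt1 lam_gt0 rho_neq1 i j; have lam_ge0 := ltW lam_gt0.
have d_neq0 : 1 - rho ^+ 2 != 0 by rewrite subr_eq0 eq_sym.
have s_neq0 : s != 0 by rewrite sqrtr_eq0 -ltNge.
have lamE : lam = s ^+ 2 by rewrite sqr_sqrtr.
pose v k := (1 - rho ^+ 2)^-1 *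
  (if (k.+1 < n)%N then (lam ^+ k.+1)^-1 else (1 - rho ^+ 2) / lam ^+ n).
pose l i j : R := if i == j then 1 else if j.+1 == i then - r else 0.
have -> : L *m V *m L^T = L *m \matrix_(i < n, j < n) (v i * l j i).
  rewrite -mulmxA /dcV -scalemxAl mul_diag_mx; congr (_ *m _).
  by apply/matrixP => a b; rewrite !mxE mulrA.
rewrite (dcL_mulmxE n (fun i j => v i * l j i)) mxE powRN powR_half //.
have := ltn_ord i; have := ltn_ord j; rewrite /dc_coef -val_eqE /= => jn iN.
have vE k : (k.+1 < n)%N -> v k = ((1 - rho ^+ 2) * s ^+ (2 * k.+1))^-1.
  by rewrite /v => ->; rewrite lamE -exprM invfM -lamE.
have vlast k : k.+1 = n -> v k = (s ^+ (2 * k.+1))^-1.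
  by move=> kn; rewrite /v kn ltnn mulrA mulVf // mul1r {1}lamE -exprM.
have l1 k : l k k = 1 by rewrite /l eqxx.
have lS k : l k.+1 k = - r by rewrite /l /= ifF ?eqxx //; lia.
have l0 a b : a != b -> b.+1 != a -> l a b = 0.
  by rewrite /l => /negPf-> /negPf->.
have sign2 k : (-1) ^+ (k + k) = 1 :> R.
  by rewrite addnn -mul2n exprM sqrrN !expr1n.
have signS k : (-1) ^+ (k + k).+1 = -1 :> R by rewrite exprS sign2 mulr1.
have dist2 : (i.+1 < j)%N || (j.+1 < i)%N -> (1 < `|i%:Z - j%:Z|)%N by lia.
case: (ltngtP i j) => [ij|ji|ij].
- have [ji1|ji1] := eqVneq (j : nat) i.+1; last first.
    rewrite dist2; last lia.
    by rewrite !mul0r !l0 ?mulr0 ?if_same ?subr0 //; lia.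
  rewrite ji1 distnS /= lS (_ : (if _ then _ else _) = 0) ?subr0; last first.
    by case: ifP => // i_gt0; rewrite l0 ?mulr0 //; lia.
  rewrite vE; last lia.
  rewrite (_ : 2 * i.+1 = i.+1 + i.+1)%N; last lia.
  rewrite (addnS i.+1 i.+1) signS; move: (i.+1 + i.+1)%N => k; rewrite !exprS.
  by field; rewrite d_neq0 s_neq0 expf_neq0.
- have [ji1|ji1] := eqVneq (i : nat) j.+1; last first.
    rewrite dist2; last lia.
    rewrite !mul0r l0 ?mulr0 ?sub0r; try lia.
    by case: ifP => i_gt0; rewrite ?oppr0 // l0 ?mulr0 ?oppr0 //; lia.
  rewrite ji1 distSn /= l1 l0 ?mulr0 ?sub0r; try lia.
  rewrite vE; last lia.
  rewrite (_ : 2 * j.+1 = j.+1 + j.+1)%N; last lia.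
  rewrite (addSn j.+1 j.+1) signS; move: (j.+1 + j.+1)%N => k; rewrite !exprS.
  by field; rewrite d_neq0 s_neq0 expf_neq0.
- rewrite -ij subrr /= sign2 l1 mulr1.
  have [i0|i_gt0] := posnP i.
    by rewrite i0 /= subr0 vE //; field; rewrite d_neq0 s_neq0.
  have lSi : l i i.-1 = - r by rewrite -{1}(prednK i_gt0) lS.
  have sE : s ^+ (2 * i.+1) = s ^+ 2 * s ^+ (2 * i.-1.+1).
    by rewrite -exprD; congr (_ ^+ _); lia.
  rewrite lSi addnn -mul2n sE (vE i.-1); last lia.
  case: (ltnP i.+1 n) => iN'.
    rewrite vE // sE ltnS i_gt0 andTb.
    by field; rewrite d_neq0 s_neq0 expf_neq0.
  rewrite vlast ?sE ?andbF; last lia.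
  by field; rewrite d_neq0 s_neq0 expf_neq0.
Qed.

Lemma banded_LVL : 0 < lam -> rho ^+ 2 != 1 -> banded_mx 1 (L *m V *m L^T).
Proof.
move=> lam_gt0 rho_neq1 i j ij; rewrite LVL_E //; last first.
  by have := ltn_ord i; have := ltn_ord j; lia.
by rewrite /dc_coef ij !mul0r.
Qed.

Lemma det_dcU : \det U = 1.
Proof.
rewrite -det_tr (det_trig upper_trig_dcU) big1 // => i _.
by rewrite !mxE eqxx.
Qed.

Lemma det_dcW : (0 < n)%N ->
  \det W = lam ^+ ((n * n.+1) %/ 2) * (1 - rho ^+ 2) ^+ n.-1.
Proof.
move=> n_gt0; rewrite det_diag.
have tri : (\sum_(i < n) i.+1 = (n * n.+1) %/ 2)%N.
  elim: n {n_gt0} => [|m IHm]; first by rewrite big_ord0.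
  by rewrite big_ord_recr /= IHm; nia.
under eq_bigr => i _.
  (* The exponent is i.+1 in both cases, as i.+1 = n in the last row. *)
  rewrite mxE (_ : (if _ then _ else _) =
    lam ^+ i.+1 * (if (i.+1 < n)%N then 1 - rho ^+ 2 else 1)); last first.
    case: ltnP => iN; first by rewrite mulrC.
    by rewrite mulr1; congr (_ ^+ _); have := ltn_ord i; lia.
  over.
rewrite big_split /= prodrXr tri; congr (_ * _).
case: n n_gt0 => // m _; rewrite big_ord_recr /= ltnn mulr1.
under eq_bigr => i _ do rewrite ltnS ltn_ord.
by rewrite prodr_const card_ord.
Qed.

(** For lam = 0 the exponents of lam are positive on both sides, so both sides
    vanish. *)
Lemma det_dc_kernel (c : R) : (0 < n)%N -> 0 <= lam ->
  \det (dc_kernel n c lam rho) =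
    c ^+ n * (lam ^+ ((n * n.+1) %/ 2) * (1 - rho ^+ 2) ^+ n.-1).
Proof.
move=> n_gt0; rewrite le_eqVlt => /predU1P[lam0 | lam_gt0].
  have -> : dc_kernel n c lam rho = 0.
    apply/matrixP => i j; rewrite !mxE -lam0 powR0 ?mulr0 ?mul0r //.
    by rewrite mulf_neq0 ?invr_eq0 ?pnatr_eq0.
  rewrite -lam0 -(prednK n_gt0) det0 expr0n (_ : _ %/ 2 == 0 = false)%N.
    by rewrite mul0r mulr0.
  by nia.
rewrite dc_kernel_UWU // detZ !det_mulmx det_tr.
by rewrite det_dcU det_dcW // mul1r mulr1.
Qed.

End DCKernel.

Theorem mainTheorem2 (R : realType) (n : nat) (c lam rho : R)
    (hn : (0 < n)%N) (hc : 0 <= c) (hlam0 : 0 <= lam) (hlam1 : lam < 1)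
    (hrho0 : -1 <= rho) (hrho1 : rho <= 1) :
  (* (i) *)
  (lam != 0 ->
   let U : 'M[R]_n := dcU n lam rho in
   let W : 'M[R]_n := dcW n lam rho in
   [/\ dc_kernel n c lam rho = c *: (U *m W *m U^T),
       upper_trig_mx U,
       toeplitz_mx U,
       is_diag_mx W
     & rho ^+ 2 != 1 ->
       W = (1 - rho ^+ 2) *: diag_mx (\row_(i < n)
         (if (i.+1 < n)%N then lam ^+ i.+1 else lam ^+ n / (1 - rho ^+ 2)))]) /\
  (* (ii) *)
  (c != 0 -> lam != 0 -> rho ^+ 2 != 1 ->
   let K : 'M[R]_n := dc_kernel n c lam rho in
   let L : 'M[R]_n := dcL n lam rho in
   let V : 'M[R]_n := dcV n lam rho in
   [/\ K \in unitmx,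
       banded_mx 1 (invmx K),
       (1 < n)%N -> forall i j : 'I_n,
         invmx K i j =
         c^-1 * (dc_coef rho i j / (1 - rho ^+ 2) * (-1) ^+ (i.+1 + j.+1)
                 * lam `^ (- ((i.+1 + j.+1)%:R / 2)) * rho ^+ `|i - j|%N)
     & [/\ invmx K = c^-1 *: (L *m V *m L^T),
           toeplitz_mx L,
           is_trig_mx L,
           banded_mx 1 L
         & is_diag_mx V]]) /\
  (* (iii) *)
  \det (dc_kernel n c lam rho) =
    c ^+ n * (lam ^+ ((n * n.+1) %/ 2) * (1 - rho ^+ 2) ^+ n.-1).
Proof.
have lam_gt0 : lam != 0 -> 0 < lam by rewrite lt_def hlam0 andbT.
split=> [lam_neq0 /= | ].
  split; [exact/dc_kernel_UWU/lam_gt0 | exact: upper_trig_dcU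
    | exact: toeplitz_dcU | exact: diag_mx_is_diag | move=> rho_neq1].
  have d_neq0 : 1 - rho ^+ 2 != 0 by rewrite subr_eq0 eq_sym.
  apply/matrixP => i j; rewrite !mxE mulrnAr; congr (_ *+ _).
  by case: ifP => // _; rewrite mulrCA divff ?mulr1.
split=> [c_neq0 lam_neq0 rho_neq1 /= | ]; last exact: det_dc_kernel.
have KLVL := dc_kernel_LVL n c_neq0 (lam_gt0 lam_neq0) rho_neq1.
have [K_unit _] := mulmx1_unit KLVL.
have KE : invmx (dc_kernel n c lam rho) =
    c^-1 *: (dcL n lam rho *m dcV n lam rho *m (dcL n lam rho)^T).
  by rewrite -[LHS]mulmx1 -KLVL mulmxA mulVmx // mul1mx.
rewrite KE; split=> //.
- by move=> i j ij; rewrite mxE banded_LVL ?mulr0 ?lam_gt0.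
- by move=> n_gt1 i j; rewrite mxE LVL_E ?lam_gt0.
- split=> //; [exact: toeplitz_dcL | exact: is_trig_dcL | exact: banded_dcL |].
  by apply/is_diag_mxP => i j ij; rewrite !mxE -val_eqE /= (negPf ij) mulr0.
Qed.
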